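(* Let $k \ge 1$ be an integer. If $G$ is a $k$-SI graph with $n(G)$ vertices and maximum degree $\Delta(G)$, then $$\Delta(G) \le \left\lfloor \frac{n(G)+k}{2} \right\rfloor,$$ where the equality holds if and only if $G \cong K_{\frac{n(G)+k}{2}, \frac{n(G)-k}{2}}$.
   Context: For a positive integer $k$, a graph $G$ is a $k$-stepwise irregular graph ($k$-SI graph) if $|d_G(u) - d_G(v)| = k$ for every edge $uv \in E(G)$, where $d_G(x)$ denotes the degree of the vertex $x$ in $G$. The order (number of vertices) of $G$ is $n(G)$, and $\Delta(G)$ is the maximum degree of $G$. $K_{p,q}$ denotes the complete bipartite graph with parts of sizes $p$ and $q$.
   Formalization: The equality characterization is asserted only when n(G)+k is even, so that K_{(n+k)/2,(n-k)/2} exists (with both parts nonempty); for n(G)+k odd the floor bound can be attained, e.g. by a connected 1-SI graph with n=8 and maximum degree 4, though no such complete bipartite graph exists. *)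

(* Defs.v *)
From mathcomp Require Import all_boot all_order all_algebra.

Set Implicit Arguments.
Unset Strict Implicit.
Unset Printing Implicit Defensive.

Record sgraph := SGraph {
  vertex :> finType;
  edge : rel vertex;
  edge_sym : symmetric edge;
  edge_irrefl : irreflexive edge }.

Definition graph_order (G : sgraph) : nat := #|G|.

Definition deg (G : sgraph) (v : G) : nat := #|[set w : G | edge v w]|.

Definition max_deg (G : sgraph) : nat := \max_(v : G) deg v.

(* The absolute difference is taken in int: subtraction on nat is truncated. *)
Definition stepwise_irregular (k : nat) (G : sgraph) : Prop :=
  forall u v : G, edge u v -> `|((deg u)%:Z - (deg v)%:Z)%R|%N = k.

Definition isomorphic (G H : sgraph) : Prop :=
  exists2 f : G -> H, bijective f & forall x y : G, edge (f x) (f y) = edge x y.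

Definition bip_edge (p q : nat) : rel ('I_p + 'I_q)%type :=
  fun x y => match x, y with
             | inl _, inr _ | inr _, inl _ => true
             | _, _ => false
             end.

Lemma bip_edge_sym p q : symmetric (@bip_edge p q).
Proof. by move=> [x|x] [y|y]. Qed.

Lemma bip_edge_irrefl p q : irreflexive (@bip_edge p q).
Proof. by case. Qed.

Definition complete_bipartite (p q : nat) : sgraph :=
  SGraph (@bip_edge_sym p q) (@bip_edge_irrefl p q).

(* Both parts of K_(p,q) are nonempty by convention; without this the edgeless
   graph on k vertices would count as K_(k,0). *)
Definition is_K (p q : nat) (G : sgraph) : Prop :=
  [/\ 0 < p, 0 < q & isomorphic G (complete_bipartite p q)].

(* Main.v *)
Require Import Defs.
From mathcomp Require Import all_boot.
From mathcomp Require Import ssralg ssrint zify.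

(** Let [v] have maximum degree [D > 0] and let [u] be a neighbour of [v]. By
    maximality [deg u = D - k], and since the endpoints of an edge have
    different degrees, [v] and [u] have no common neighbour; hence
    [D + (D - k) <= n]. In case of equality the neighbourhoods of [v] and [u]
    partition the vertices for every neighbour [u] of [v], so all edges between
    [N(v)] and its complement are present, and as the degrees on both sides are
    then already exhausted there are no others. *)

Set Implicit Arguments.
Unset Strict Implicit.
Unset Printing Implicit Defensive.

Definition nbrs (G : sgraph) (v : G) : {set G} := [set w | edge v w].

Lemma deg_le_max (G : sgraph) (v : G) : deg v <= max_deg G.
Proof. exact: (leq_bigmax (F := @deg G)). Qed.

Lemma deg_isomorphism (G H : sgraph) (f : G -> H) (x : G) :
  bijective f -> (forall x y, edge (f x) (f y) = edge x y) ->
  deg (f x) = deg x.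
Proof.
move=> bij_f edge_f; rewrite /deg -(on_card_preimset (f := f)); last first.
  by apply: onW_bij.
by apply: eq_card => y; rewrite !inE edge_f.
Qed.

Lemma deg_complete_bipartite_inr (p q : nat) (j : 'I_q) :
  @deg (complete_bipartite p q) (inr j) = p.
Proof.
rewrite /deg -[RHS]card_ord -(card_imset 'I_p (@inl_inj 'I_p 'I_q)).
apply: eq_card => -[i|i]; rewrite inE /=.
  by rewrite imset_f.
by symmetry; apply/imsetP => -[].
Qed.

(** The members [a] and [b] serve as defaults for [enum_rank_in], which numbers each side by an
    ordinal. *)
Lemma isomorphic_complete_bipartite (G : sgraph) (A : {set G}) (a b : G) :
  a \in A -> b \in ~: A ->
  (forall x y : G, edge x y = (x \in A) (+) (y \in A)) ->
  isomorphic G (complete_bipartite #|A| #|~: A|).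
Proof.
move=> aA bA edgeE.
pose f (x : G) : complete_bipartite #|A| #|~: A| :=
  if x \in A then inl (enum_rank_in aA x) else inr (enum_rank_in bA x).
exists f; last first.
  by move=> x y; rewrite edgeE /f; do 2!case: ifP.
exists (fun s => match s with inl i => enum_val i | inr j => enum_val j end).
  move=> x; rewrite /f; case: ifP => xA; rewrite enum_rankK_in //.
  by rewrite inE xA.
case=> i; rewrite /f.
  by rewrite enum_valP enum_valK_in.
by have := enum_valP i; rewrite inE => /negPf ->; rewrite enum_valK_in.
Qed.

Section StepwiseIrregular.

Variables (k : nat) (G : sgraph).
Hypotheses (k_gt0 : 0 < k) (G_SI : stepwise_irregular k G).

(** Two neighbours of a vertex [w] have degrees [deg w - k] or [deg w + k], so these differ by 0 or
    2k, never by k > 0. *)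
Lemma SI_nbrs_disjoint (x y : G) : edge x y -> [disjoint nbrs x & nbrs y].
Proof.
move=> xy; apply/pred0P => w /=; rewrite !inE; apply/negP => /andP [xw yw].
by have := G_SI xy; have := G_SI xw; have := G_SI yw; lia.
Qed.

Lemma SI_deg_nbr_max (v u : G) :
  deg v = max_deg G -> edge v u -> deg u + k = max_deg G.
Proof. by move=> vmax /G_SI; have := deg_le_max u; lia. Qed.

Lemma SI_max_deg_bound (v u : G) :
  deg v = max_deg G -> edge v u -> max_deg G + max_deg G <= graph_order G + k.
Proof.
move=> vmax vu; have := SI_deg_nbr_max vmax vu.
have /leP := max_card [in nbrs v :|: nbrs u].
rewrite cardsU disjoint_setI0 ?SI_nbrs_disjoint // cards0.
by move: vmax; rewrite /graph_order /deg /nbrs; lia.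
Qed.

Lemma SI_extremal_edge (v u0 : G) :
  deg v = max_deg G -> edge v u0 ->
  max_deg G + max_deg G = graph_order G + k ->
  forall x y : G, edge x y = (x \in nbrs v) (+) (y \in nbrs v).
Proof.
move=> vmax vu0 eqD.
have nbrs_nbr u : edge v u -> nbrs u = ~: nbrs v.
  move=> vu; apply/eqP; rewrite eqEcard; apply/andP; split.
    by rewrite subsets_disjoint setCK disjoint_sym SI_nbrs_disjoint.
  have := cardsC (nbrs v); have := SI_deg_nbr_max vmax vu.
  by move: vmax eqD; rewrite /graph_order /deg /nbrs; lia.
(* Each [u] in [nbrs v] is adjacent to all of the complement, hence to [w]. So [nbrs v] lies in
   [nbrs w], and maximality of [deg v] forces equality. *)
have nbrs_far w : w \notin nbrs v -> nbrs w = nbrs v.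
  move=> wNv; apply/esym/eqP; rewrite eqEcard; apply/andP; split.
    apply/subsetP => u; rewrite [u \in nbrs v]inE => /nbrs_nbr /setP /(_ w).
    by rewrite [RHS]inE wNv !inE edge_sym.
  by have := deg_le_max w; rewrite -vmax.
move=> x y; have -> : edge x y = (y \in nbrs x) by rewrite inE.
case: (boolP (x \in nbrs v)) => [|/nbrs_far -> //].
by rewrite inE => /nbrs_nbr ->; rewrite inE.
Qed.

End StepwiseIrregular.

Lemma max_deg_attained (G : sgraph) :
  0 < max_deg G -> exists v u : G, deg v = max_deg G /\ edge v u.
Proof.
move=> D_gt0.
(* Over an empty vertex type the maximum is 0 by default and is attained by no vertex. *)
have /card_gt0P [v0 _] : 0 < #|G|.
  rewrite lt0n; apply/eqP => /card0_eq G0; move: D_gt0.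
  by rewrite /max_deg big1 // => v; have := G0 v; rewrite inE.
have [v vmax] : {v : G | max_deg G = deg v}.
  by apply: eq_bigmax; apply/card_gt0P; exists v0.
move: D_gt0; rewrite vmax => /card_gt0P [u]; rewrite inE => vu.
by exists v, u.
Qed.

Theorem theorem4p2 (k : nat) (G : sgraph) (k_ge1 : 1 <= k)
    (G_SI : stepwise_irregular k G) :
  max_deg G <= (graph_order G + k) %/ 2
  /\ (2 %| graph_order G + k ->
      (max_deg G = (graph_order G + k) %/ 2
       <-> is_K ((graph_order G + k) %/ 2) ((graph_order G - k) %/ 2) G)).
Proof.
have bound : max_deg G <= (graph_order G + k) %/ 2.
  case: (posnP (max_deg G)) => [-> //|/max_deg_attained [v [u [vmax vu]]]].
  by have := SI_max_deg_bound k_ge1 G_SI vmax vu; lia.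
split=> // even_nk; split=> [eqD | [p_gt0 q_gt0 [f bij_f edge_f]]].
  (* Being even and positive, n + k is at least 2, so the maximum degree is positive. *)
  have [|v [u [vmax vu]]] := @max_deg_attained G; first by lia.
  have eq2D : max_deg G + max_deg G = graph_order G + k by lia.
  have uN : u \in nbrs v by rewrite inE.
  have vN : v \in ~: nbrs v by rewrite !inE edge_irrefl.
  have pE : #|nbrs v| = (graph_order G + k) %/ 2 by rewrite -eqD -vmax.
  (* The subtraction does not truncate: D <= n and 2D = n + k give k <= n. *)
  have qE : #|~: nbrs v| = (graph_order G - k) %/ 2.
    by have := cardsC (nbrs v); move: pE eqD eq2D; rewrite /graph_order; lia.
  rewrite -pE -qE; split.
  - by apply/card_gt0P; exists u.
  - by apply/card_gt0P; exists v.
  - apply: (isomorphic_complete_bipartite uN vN).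
    exact: (SI_extremal_edge k_ge1 G_SI vmax vu eq2D).
(* Only the lower bound on the maximum degree remains. A vertex of the right part, nonempty by
   [q_gt0], has degree (n + k)/2, and the isomorphism carries it back to [G]. *)
apply/eqP; rewrite eqn_leq bound /=.
have [g _ gK] := bij_f.
have <- := deg_complete_bipartite_inr ((graph_order G + k) %/ 2) (Ordinal q_gt0).
by rewrite -[inr _]gK (deg_isomorphism _ bij_f edge_f) deg_le_max.
Qed.
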